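(* Let $m,\hat n,\tilde n\ge 1$ be integers, let $n=\hat n\cdot\tilde n$, and let $A\in\mathbb{R}^{m\times n}$. Let $\hat x$ and $\tilde x$ be random vectors with values in $\mathbb{R}^{\hat n}$ and $\mathbb{R}^{\tilde n}$, respectively, whose $\hat n+\tilde n$ entries altogether are independent real random variables with mean zero and variance one. Then $$\mathbb{E}\big[\|A(\tilde x\otimes\hat x)\|_2^2\big]=\|A\|_F^2 .$$
   Context: $\otimes$ denotes the Kronecker product, so $\tilde x\otimes\hat x\in\mathbb{R}^n$ for $\tilde x\in\mathbb{R}^{\tilde n}$, $\hat x\in\mathbb{R}^{\hat n}$. $\|\cdot\|_2$ is the Euclidean norm of a vector and $\|\cdot\|_F$ is the Frobenius norm of a matrix. *)

(* Defs.v *)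
From HB Require Import structures.
From mathcomp Require Import all_boot all_order all_algebra.
From mathcomp Require Import all_classical all_reals all_analysis.
From mathcomp Require Export mxtens.

Set Implicit Arguments.
Unset Strict Implicit.
Unset Printing Implicit Defensive.

Import Order.TTheory GRing.Theory Num.Theory.
Import numFieldNormedType.Exports.

Local Open Scope classical_set_scope.
Local Open Scope ring_scope.

(* The norm on matrices provided by MathComp-Analysis is the sup norm. *)
Definition euclidean_norm {R : realType} {n : nat} (v : 'cV[R]_n) : R :=
  Num.sqrt (\sum_(i < n) v i ord0 ^+ 2).

Definition frobenius_norm {R : realType} {m n : nat} (A : 'M[R]_(m, n)) : R :=
  Num.sqrt (\sum_(i < m) \sum_(j < n) A i j ^+ 2).

(* In coordinates, (x *t y) has entry [x i * y j] at position [i * q + j]; the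
   ascription is needed because [x *t y] has [1 * 1] columns. *)
Definition kron {R : realType} {p q : nat} (x : 'cV[R]_p) (y : 'cV[R]_q) :
  'cV[R]_(p * q) := x *t y.

(* There is no measurable structure on ['cV[R]_n] in the library; measurability
   for the product (Borel) sigma-algebra is measurability of every entry. *)
Definition random_vector {d : measure_display} {T : measurableType d}
    {R : realType} {n : nat} (X : T -> 'cV[R]_n) : Prop :=
  forall i : 'I_n, measurable_fun [set: T] (fun t => X t i ord0).

Definition independent_rvs {d : measure_display} {T : measurableType d}
    {R : realType} (P : probability T R) {I : finType} (X : I -> T -> R) :
    Prop :=
  forall (J : {set I}) (B : I -> set R), (forall i, measurable (B i)) ->
    P (\bigcap_(i in [set` J]) (X i @^-1` B i)) =
    (\prod_(i in J) P (X i @^-1` B i))%E.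

Definition joint_entries {T : Type} {R : realType} {p q : nat}
    (X : T -> 'cV[R]_p) (Y : T -> 'cV[R]_q) (k : 'I_p + 'I_q) : T -> R :=
  match k with
  | inl i => fun t => X t i ord0
  | inr j => fun t => Y t j ord0
  end.

(* Main.v *)
Require Import Defs.
From HB Require Import structures.
From mathcomp Require Import all_boot all_order all_algebra.
From mathcomp Require Import all_classical all_reals all_analysis.
From mathcomp Require Import measurable_realfun.

Set Implicit Arguments.
Unset Strict Implicit.
Unset Printing Implicit Defensive.

Import Order.TTheory GRing.Theory Num.Theory.
Import numFieldNormedType.Exports.
Import HBNNSimple.

Local Open Scope classical_set_scope.
Local Open Scope ring_scope.

(** Put [z t = xtilde t (x) xhat t].  Expanding the square gives
    [||A z||^2 = \sum_i \sum_a \sum_b A i a * A i b * z_a * z_b], so it is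
    enough that [E[z_a z_b]] is 1 if [a = b] and 0 otherwise
    ([expectation_norm2_isotropic]).

    Each [z_a z_b] is a product of four entries of [xtilde] and [xhat], hence a
    monomial in the independent family of all entries.  An entry of [xtilde] and
    an entry of [xhat] never coincide, so no exponent exceeds 2, and by
    independence [E[z_a z_b]] is a product of moments of order 0, 1 and 2,
    which are 1, 0 and 1 ([standardized_moments]).  All exponents are even
    exactly when [a = b]; otherwise some exponent is 1 and the product vanishes
    ([isotropic_kron]).  Moments of order 4, which may be infinite, never occur.

    The analytic content is the product rule [integral_prod_indep]: for
    independent [X_k] and integrable [f_k (X_k)], the expectation of
    [\prod_k f_k (X_k)] is the product of the expectations.  Independence is the
    case where all [f_k] are indicators; the indicators are then exchanged one
    coordinate at a time, first for nonnegative functions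
    ([ge0_integral_prod_indep], by simple functions and monotone convergence),
    then for signed ones through positive and negative parts. *)

(** * Expectations of products of functions of independent variables *)

(** The one-coordinate step of the product rule: both sides are monotone linear
    functionals of [f] that agree on indicators, so they agree on nonnegative
    simple functions and, by monotone convergence, on all nonnegative measurable
    functions.  [W] stands for the product over the other coordinates and [c]
    for its expectation; [c] is finite so that multiplication by [c] is
    continuous at the limit. *)
Lemma ge0_integral_factor (R : realType) (d : measure_display)
    (T : measurableType d) (P : probability T R) (X W : T -> R) (c : \bar R) :
  measurable_fun [set: T] X -> measurable_fun [set: T] W ->
  (forall t, 0 <= W t) -> c \is a fin_num ->
  (forall B, measurable B ->
    (\int[P]_t (\1_B (X t) * W t)%:E = P (X @^-1` B) * c)%E) ->
  forall f : R -> R, measurable_fun [set: R] f -> (forall x, 0 <= f x) ->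
    (\int[P]_t (f (X t) * W t)%:E = \int[P]_t (f (X t))%:E * c)%E.
Proof.
move=> mX mW W0 cfin factB f mf f0.
have mcomp (g : R -> R) : measurable_fun [set: R] g ->
    measurable_fun [set: T] (fun t => g (X t)).
  by move=> mg; exact: measurableT_comp.
(* A nonnegative simple function is a finite combination of indicators with
   coefficients in its range. *)
have factS (g : {nnsfun R >-> R}) :
    (\int[P]_t (g (X t) * W t)%:E = \int[P]_t (g (X t))%:E * c)%E.
  pose s : seq R := finmap.enum_fset (fset_set (range g)).
  pose A i := g @^-1` [set s`_i].
  have s0 (i : 'I_(size s)) : 0 <= s`_i.
    have : s`_i \in s by rewrite mem_nth.
    by rewrite in_fset_set// inE => -[y _ <-].
  have mA i : measurable (A i) by exact: measurable_sfunP.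
  have mXA i : measurable (X @^-1` A i) by rewrite -[X in measurable X]setTI; exact: mX.
  have m1 i : measurable_fun [set: T] (fun t => \1_(A i) (X t) : R).
    by apply: mcomp; exact: measurable_indic.
  transitivity (\int[P]_t (\sum_(i < size s)
     (s`_i)%:E * (\1_(A i) (X t) * W t)%:E))%E.
    apply: eq_integral => t _; rewrite (fimfunEord g) -/s mulr_suml -sumEFin.
    by apply: eq_bigr => i _; rewrite -EFinM mulrA.
  rewrite ge0_integral_sum//; first last.
  - by move=> i t _; rewrite -EFinM lee_fin !mulr_ge0.
  - move=> i; apply/measurable_EFinP/measurable_funM => //; exact: measurable_funM.
  transitivity ((\int[P]_t (\sum_(i < size s)
     (s`_i)%:E * (\1_(A i) (X t))%:E)) * c)%E; last first.
    congr (_ * _)%E; apply: eq_integral => t _.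
    rewrite (fimfunEord g) -/s -sumEFin.
    by apply: eq_bigr => i _; rewrite -EFinM.
  rewrite ge0_integral_sum//; first last.
  - by move=> i t _; rewrite -EFinM lee_fin !mulr_ge0.
  - by move=> i; apply/measurable_EFinP/measurable_funM.
  rewrite ge0_sume_distrl; last first.
    by move=> i _; apply: integral_ge0 => t _; rewrite -EFinM lee_fin mulr_ge0.
  apply: eq_bigr => i _.
  rewrite ge0_integralZl_EFin//; first last.
  - by apply/measurable_EFinP/measurable_funM.
  - by move=> t _; rewrite lee_fin mulr_ge0.
  rewrite ge0_integralZl_EFin//; first last.
  - exact/measurable_EFinP.
  rewrite factB// -muleA; congr (_ * (_ * _))%E.
  rewrite [RHS](_ : _ = \int[P]_t (\1_(X @^-1` A i) t)%:E)%E.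
    by rewrite integral_indic// setIT.
  by apply: eq_integral => t _; rewrite !indicE.
have mfE : measurable_fun [set: R] (EFin \o f) by exact/measurable_EFinP.
pose g := nnsfun_approx measurableT mfE.
have gf x : (g n x)%:E @[n --> \oo] --> (f x)%:E.
  by apply: (@cvg_nnsfun_approx _ _ _ _ measurableT _ mfE) => // y _; rewrite lee_fin.
have ndg x : {homo (fun n => g n x) : m n / (m <= n)%N >-> m <= n}.
  by move=> m n mn; exact/lefP/nd_nnsfun_approx.
have cvgM (V : T -> R) : measurable_fun [set: T] V -> (forall t, 0 <= V t) ->
    (\int[P]_t (g n (X t) * V t)%:E)%E @[n --> \oo] -->
    (\int[P]_t (f (X t) * V t)%:E)%E.
  move=> mV V0.
  rewrite [X in _ --> X](_ : _ =
      \int[P]_t limn (fun n => (g n (X t) * V t)%:E))%E; last first.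
    apply: eq_integral => t _; apply/esym/cvg_lim => //.
    rewrite EFinM; under eq_fun do rewrite EFinM.
    exact: cvgeZr.
  apply: cvg_monotone_convergence => //.
  - by move=> n; apply/measurable_EFinP/measurable_funM => //; exact: mcomp.
  - by move=> n t _; rewrite lee_fin mulr_ge0.
  - by move=> t _ m n mn; rewrite lee_fin ler_wpM2r// ndg.
have := cvgM _ mW W0; under eq_fun do rewrite factS.
move=> /cvg_unique; apply => //.
apply: cvgeZr => //.
(* The other limit is the instance of cvgM with weight 1. *)
have mul1 (h : T -> R) :
    (\int[P]_t (h t)%:E = \int[P]_t (h t * cst 1 t)%:E)%E.
  by apply: eq_integral => t _; rewrite mulr1.
rewrite mul1; under eq_fun do rewrite mul1.
by apply: cvgM => // t; exact: ler01.
Qed.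

(** Replacing the function attached to one coordinate, as the inductions below
    do, changes a single factor of the product. *)
Lemma big_update (V : Type) (idx : V) (op : Monoid.com_law idx) (I : finType)
    (S : Type) (F : I -> S -> V) (f : I -> S) (k0 : I) (s : S) :
  \big[op/idx]_k F k ([eta f with k0 |-> s] k) =
  op (F k0 s) (\big[op/idx]_(k | k != k0) F k (f k)).
Proof.
rewrite (bigD1 k0)//= eqxx; congr (op _ _).
by apply: eq_bigr => k /negbTE ->.
Qed.

Lemma probability_indic_indep (R : realType) (d : measure_display)
    (T : measurableType d) (P : probability T R) (I : finType)
    (X : I -> T -> R) (B : I -> set R) :
  (forall k, measurable_fun [set: T] (X k)) -> independent_rvs P X ->
  (forall k, measurable (B k)) ->
  (\int[P]_t (\prod_k \1_(B k) (X k t))%:E =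
   \prod_k \int[P]_t (\1_(B k) (X k t))%:E)%E.
Proof.
move=> mX indep mB.
have mXB k : measurable (X k @^-1` B k).
  by rewrite -[X in measurable X]setTI; exact: mX.
transitivity (P (\bigcap_(k in [set` [set: I]%SET]) (X k @^-1` B k))).
  rewrite -[X in P X]setIT -integral_indic//; last first.
    by apply: fin_bigcap_measurable.
  apply: eq_integral => t _; congr EFin; rewrite indicE.
  have [tB|] := boolP (t \in _).
    rewrite big1// => k _; rewrite indicE mem_set//.
    by move: tB; rewrite inE => /(_ k); apply; rewrite /= inE.
  move=> tB; apply/eqP/prodf_eq0.
  have [k tBk] : exists k, ~ B k (X k t).
    apply/existsNP => tBk; move/negP: tB; apply; rewrite inE => k _.
    exact: tBk.
  by exists k => //; rewrite indicE memNset.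
rewrite indep//; apply: eq_big => [k|k _]; first by rewrite inE.
by rewrite -[X in P X]setIT -integral_indic.
Qed.

(** Induction on the number of coordinates whose function is not an indicator:
    such a coordinate is handled by [ge0_integral_factor], whose hypothesis asks
    for the rule with that function replaced by an indicator. *)
Lemma ge0_integral_prod_indep (R : realType) (d : measure_display)
    (T : measurableType d) (P : probability T R) (I : finType)
    (X : I -> T -> R) (f : I -> R -> R) :
  (forall k, measurable_fun [set: T] (X k)) -> independent_rvs P X ->
  (forall k, measurable_fun [set: R] (f k)) -> (forall k x, 0 <= f k x) ->
  (forall k, \int[P]_t (f k (X k t))%:E \is a fin_num)%E ->
  (\int[P]_t (\prod_k f k (X k t))%:E = \prod_k \int[P]_t (f k (X k t))%:E)%E.
Proof.
move=> mX indep mf f0 fint.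
suff main n : forall f : I -> R -> R,
    (forall k, measurable_fun [set: R] (f k)) -> (forall k x, 0 <= f k x) ->
    (forall k, \int[P]_t (f k (X k t))%:E \is a fin_num)%E ->
    forall J : {set I}, #|J| = n ->
    (forall k, k \notin J -> exists B, measurable B /\ f k = \1_B) ->
    (\int[P]_t (\prod_k f k (X k t))%:E =
     \prod_k \int[P]_t (f k (X k t))%:E)%E.
  by apply: (main #|[set: I]%SET| f _ _ _ [set: I]%SET) => // k; rewrite inE.
elim: n => [|n IH] {mf f0 fint} {}f mf f0 fint J cardJ fJ.
  have /choice[B mB] k : exists B, measurable B /\ f k = \1_B.
    by apply: fJ; rewrite (cards0_eq cardJ) inE.
  have -> : f = (fun k => \1_(B k)) by apply/funext => k; case: (mB k).
  by apply: probability_indic_indep => // k; case: (mB k).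
have /card_gt0P[k0 k0J] : (0 < #|J|)%N by rewrite cardJ.
pose W t := \prod_(k | k != k0) f k (X k t).
have split s t : \prod_k [eta f with k0 |-> s] k (X k t) = s (X k0 t) * W t.
  exact: (big_update _ (fun k g => g (X k t))).
transitivity (\int[P]_t (f k0 (X k0 t) * W t)%:E)%E.
  by apply: eq_integral => t _; rewrite (bigD1 k0).
rewrite [RHS](bigD1 k0)//=; apply: ge0_integral_factor => //.
- rewrite /W; under eq_fun do rewrite -big_filter.
  by apply: measurable_prod => k _; exact: measurableT_comp.
- by move=> t; exact: prodr_ge0.
- exact: prode_fin_num.
move=> B mB; under eq_integral do rewrite -split.
have mXB : measurable (X k0 @^-1` B).
  by rewrite -[X in measurable X]setTI; exact: mX.
have intB : (\int[P]_t (\1_B (X k0 t))%:E = P (X k0 @^-1` B))%E.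
  by rewrite -[X in P X]setIT -integral_indic.
rewrite (IH _ _ _ _ (J :\ k0)%SET).
- rewrite (big_update _ (fun k g => \int[P]_t (g (X k t))%:E)%E).
  by rewrite intB.
- by move=> k /=; case: ifP => // _; exact: measurable_indic.
- by move=> k x /=; case: ifP.
- move=> k /=; case: ifP => [/eqP ->|//]; rewrite intB.
  exact: fin_num_measure.
- by move: cardJ; rewrite (cardsD1 k0) k0J => -[].
move=> k /=; rewrite !inE; case: eqP => [_ _|_ /= kJ]; last exact: fJ.
by exists B.
Qed.

(** Independence is what makes the product integrable: the nonnegative rule,
    applied to the absolute values, bounds the integral of its norm by a product
    of finite numbers. *)
Lemma integrable_prod_indep (R : realType) (d : measure_display)
    (T : measurableType d) (P : probability T R) (I : finType)
    (X : I -> T -> R) (f : I -> R -> R) :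
  (forall k, measurable_fun [set: T] (X k)) -> independent_rvs P X ->
  (forall k, measurable_fun [set: R] (f k)) ->
  (forall k, P.-integrable [set: T] (EFin \o (f k \o X k))) ->
  P.-integrable [set: T] (fun t => (\prod_k f k (X k t))%:E).
Proof.
move=> mX indep mf fint; apply/integrableP; split.
  apply/measurable_EFinP; apply: measurable_prod => k _.
  exact: measurableT_comp.
have absint k : (\int[P]_t (`|f k (X k t)|)%:E \is a fin_num)%E.
  rewrite ge0_fin_numE; last by apply: integral_ge0 => t _; rewrite lee_fin.
  by case/integrableP: (fint k).
under eq_integral do rewrite abse_EFin normr_prod.
rewrite (@ge0_integral_prod_indep _ _ _ _ _ _ (fun k x => `|f k x|))//.
  by rewrite ltey_eq prode_fin_num.
by move=> k; exact: measurableT_comp.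
Qed.

(** Induction on the number of coordinates whose function may change sign: both
    sides are additive in each coordinate, so such a function can be replaced by
    its positive and its negative part. *)
Lemma integral_prod_indep (R : realType) (d : measure_display)
    (T : measurableType d) (P : probability T R) (I : finType)
    (X : I -> T -> R) (f : I -> R -> R) :
  (forall k, measurable_fun [set: T] (X k)) -> independent_rvs P X ->
  (forall k, measurable_fun [set: R] (f k)) ->
  (forall k, P.-integrable [set: T] (EFin \o (f k \o X k))) ->
  (\int[P]_t (\prod_k f k (X k t))%:E = \prod_k \int[P]_t (f k (X k t))%:E)%E.
Proof.
move=> mX indep mf fint.
suff main n : forall f : I -> R -> R,
    (forall k, measurable_fun [set: R] (f k)) ->
    (forall k, P.-integrable [set: T] (EFin \o (f k \o X k))) ->
    forall J : {set I}, #|J| = n ->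
    (forall k, k \notin J -> forall x, 0 <= f k x) ->
    (\int[P]_t (\prod_k f k (X k t))%:E =
     \prod_k \int[P]_t (f k (X k t))%:E)%E.
  by apply: (main #|[set: I]%SET| f _ _ [set: I]%SET) => // k; rewrite inE.
elim: n => [|n IH] {mf fint} {}f mf fint J cardJ f0.
  apply: ge0_integral_prod_indep => // k; last first.
    exact: (integrable_fin_num measurableT (fint k)).
  by apply: f0; rewrite (cards0_eq cardJ) inE.
have /card_gt0P[k0 k0J] : (0 < #|J|)%N by rewrite cardJ.
have mfp : measurable_fun [set: R] (f k0)^\+ by exact: measurable_funrpos.
have mfn : measurable_fun [set: R] (f k0)^\- by exact: measurable_funrneg.
have intp : P.-integrable [set: T] (EFin \o ((f k0)^\+ \o X k0)).
  exact: (integrable_funrpos measurableT (fint k0)).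
have intn : P.-integrable [set: T] (EFin \o ((f k0)^\- \o X k0)).
  exact: (integrable_funrneg measurableT (fint k0)).
have fE x : f k0 x = (f k0)^\+ x - (f k0)^\- x.
  by rewrite -[in LHS](funrposBneg (f k0)).
have upd s : measurable_fun [set: R] s ->
    P.-integrable [set: T] (EFin \o (s \o X k0)) -> (forall x, 0 <= s x) ->
    P.-integrable [set: T]
      (fun t => (\prod_k [eta f with k0 |-> s] k (X k t))%:E) /\
    (\int[P]_t (\prod_k [eta f with k0 |-> s] k (X k t))%:E =
     \int[P]_t (s (X k0 t))%:E * \prod_(k | k != k0) \int[P]_t (f k (X k t))%:E)%E.
  move=> ms is_ s0.
  have mfs k : measurable_fun [set: R] ([eta f with k0 |-> s] k).
    by rewrite /=; case: ifP.
  have ifs k : P.-integrable [set: T] (EFin \o ([eta f with k0 |-> s] k \o X k)).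
    by rewrite /=; case: ifP => // /eqP ->.
  split; first exact: integrable_prod_indep.
  rewrite (IH _ _ _ (J :\ k0)%SET)//.
  - by rewrite (big_update _ (fun k g => \int[P]_t (g (X k t))%:E)%E).
  - by move: cardJ; rewrite (cardsD1 k0) k0J => -[].
  - by move=> k /=; rewrite !inE; case: eqP => //= _; exact: f0.
have [iWp Ep] := upd _ mfp intp (funrpos_ge0 _).
have [iWn En] := upd _ mfn intn (funrneg_ge0 _).
transitivity (\int[P]_t ((\prod_k [eta f with k0 |-> (f k0)^\+] k (X k t))%:E -
    (\prod_k [eta f with k0 |-> (f k0)^\-] k (X k t))%:E))%E.
  apply: eq_integral => t _; rewrite -EFinB; congr EFin.
  rewrite !(big_update _ (fun k g => g (X k t))) -mulrBl -fE.
  by rewrite (bigD1 k0).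
rewrite integralB_EFin// Ep En [RHS](bigD1 k0)//=.
have pfin (g : T -> R) : P.-integrable [set: T] (EFin \o g) ->
    (\int[P]_t (g t)%:E \is a fin_num)%E.
  by move=> ig; exact: integrable_fin_num.
rewrite -muleBl//; last 2 first.
- by apply: prode_fin_num => k _; exact: (pfin (f k \o X k)).
- by apply: fin_num_adde_defr; exact: (pfin ((f k0)^\+ \o X k0)).
congr (_ * _)%E; rewrite -integralB_EFin//.
by apply: eq_integral => t _; rewrite -EFinB -fE.
Qed.

(** * Moments of standardized variables *)

(** The integral is the difference of those of the positive and negative parts,
    with [+oo - +oo = -oo]; it can only be finite when both are.  This is how
    a finite mean or variance yields integrability. *)
Lemma integrable_of_integral_fin_num (R : realType) (d : measure_display)
    (T : measurableType d) (mu : {measure set T -> \bar R}) (f : T -> \bar R) :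
  measurable_fun [set: T] f -> (\int[mu]_t f t)%E \is a fin_num ->
  mu.-integrable [set: T] f.
Proof.
move=> mf ffin; apply/integrableP; split => //.
have mfp := measurable_funepos mf; have mfn := measurable_funeneg mf.
rewrite [X in (X < _)%E](_ : _ = \int[mu]_t (f^\+ t + f^\- t))%E; last first.
  by apply: eq_integral => t _; exact: (congr1 (@^~ t) (fune_abse f)).
rewrite ge0_integralD//.
move: ffin; rewrite integralE.
have := @integral_ge0 _ _ _ mu setT f^\+%E (fun t _ => funepos_ge0 f t).
have := @integral_ge0 _ _ _ mu setT f^\-%E (fun t _ => funeneg_ge0 f t).
move: (\int[mu]_(_ in _) f^\+%E _)%E (\int[mu]_(_ in _) f^\-%E _)%E.
by move=> [u| |] [v| |]//= _ _ _; rewrite -EFinD ltry.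
Qed.

Lemma standardized_moments (R : realType) (d : measure_display)
    (T : measurableType d) (P : probability T R) (X : T -> R) (n : nat) :
  measurable_fun [set: T] X -> 'E_P[X]%E = 0%E -> 'V_P[X]%E = 1%E ->
  (n <= 2)%N ->
  P.-integrable [set: T] (fun t => (X t ^+ n)%:E) /\
  (\int[P]_t (X t ^+ n)%:E = ((n != 1)%N%:R)%:E)%E.
Proof.
move=> mX EX VX n2.
have moment : (\int[P]_t (X t ^+ n)%:E = ((n != 1)%N%:R)%:E)%E.
  case: n n2 => [|[|[|//]]] _.
  - by transitivity 'E_P[cst (1%R : R)]%E; [rewrite unlock|exact: expectation_cst].
  - by transitivity 'E_P[X]%E; [rewrite unlock|].
  - transitivity 'V_P[X]%E => //; rewrite /variance unlock EX unlock.
    by apply: eq_integral => t _; rewrite /= !fctE /= subr0 expr2.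
split=> //; apply: integrable_of_integral_fin_num; last by rewrite moment.
by apply/measurable_EFinP; exact: measurable_funX.
Qed.

Lemma prod_expr_delta (R : comPzRingType) (I : finType) (x : I -> R) (i j : I) :
  \prod_k x k ^+ ((k == i) + (k == j)) = x i * x j.
Proof.
have delta i0 : \prod_k x k ^+ (k == i0) = x i0.
  rewrite (bigD1 i0)//= eqxx expr1 big1 ?mulr1// => k /negbTE ->.
  by rewrite expr0.
by under eq_bigr do rewrite exprD; rewrite big_split/= !delta.
Qed.

(** * Isotropic random vectors *)

(** The matrix of second moments [E[Z Z^T]] is the identity. *)
Definition isotropic (R : realType) (d : measure_display)
    (T : measurableType d) (P : probability T R) (n : nat)
    (Z : T -> 'cV[R]_n) : Prop :=
  forall a b : 'I_n,
    P.-integrable [set: T] (fun t => (Z t a ord0 * Z t b ord0)%:E) /\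
    (\int[P]_t (Z t a ord0 * Z t b ord0)%:E = ((a == b)%:R)%:E)%E.

(** Two positions [a] and [b] of the Kronecker product correspond to pairs of
    indices.  If the pairs differ in one component, the entry with that index
    occurs with exponent 1 in [z_a z_b] and has mean zero. *)
Lemma isotropic_kron (R : realType) (d : measure_display)
    (T : measurableType d) (P : probability T R) (p q : nat)
    (X : T -> 'cV[R]_p) (Y : T -> 'cV[R]_q) :
  random_vector X -> random_vector Y ->
  independent_rvs P (joint_entries Y X) ->
  (forall k, 'E_P[joint_entries Y X k] = 0)%E ->
  (forall k, 'V_P[joint_entries Y X k] = 1)%E ->
  isotropic P (fun t => kron (X t) (Y t)).
Proof.
move=> rX rY indep mean0 var1 a b.
pose x := joint_entries Y X.
have mx k : measurable_fun [set: T] (x k) by case: k => i; [exact: rY|exact: rX].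
(* The exponent of each entry in z_a z_b. *)
pose e (k : 'I_q + 'I_p) : nat := match k with
  | inl j => ((j == (mxtens_unindex a).2) + (j == (mxtens_unindex b).2))%N
  | inr i => ((i == (mxtens_unindex a).1) + (i == (mxtens_unindex b).1))%N
  end.
have e2 k : (e k <= 2)%N by case: k => i /=; do 2 case: eqP.
have mom k := standardized_moments (mx k) (mean0 k) (var1 k) (e2 k).
have kronE t c : kron (X t) (Y t) c ord0 =
    X t (mxtens_unindex c).1 ord0 * Y t (mxtens_unindex c).2 ord0.
  by rewrite /kron /tensmx mxE !ord1.
have prodE t : kron (X t) (Y t) a ord0 * kron (X t) (Y t) b ord0 =
    \prod_k x k t ^+ e k.
  rewrite !kronE mulrACA mulrC -(prod_expr_delta (fun j => Y t j ord0)).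
  by rewrite -(prod_expr_delta (fun i => X t i ord0)) [RHS]big_sumType.
have mpow k : measurable_fun [set: R] (fun r : R => r ^+ e k).
  exact: measurable_funX.
under [X in integrable _ _ X]eq_fun do rewrite prodE.
under eq_integral do rewrite prodE.
split.
  apply: (integrable_prod_indep (f := fun k r => r ^+ e k)) => // k.
  by case: (mom k).
rewrite (integral_prod_indep (f := fun k r => r ^+ e k))//; last first.
  by move=> k; case: (mom k).
under eq_bigr do rewrite (mom _).2.
rewrite prodEFin; congr EFin.
have [ab|ab] := eqVneq a b.
  by rewrite big1// => -[] i _; rewrite /e ab; case: (i == _).
(* An entry with exponent 1 contributes its mean, a zero factor. *)
suff [k ek] : exists k, e k = 1%N by rewrite (bigD1 k)//= ek mul0r.
have : mxtens_unindex a != mxtens_unindex b.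
  by rewrite (can_eq (@mxtens_unindexK _ _)).
rewrite -pair_eqE negb_and => /orP[] ne.
- by exists (inr (mxtens_unindex a).1); rewrite /= eqxx (negbTE ne).
- by exists (inl (mxtens_unindex a).2); rewrite /= eqxx (negbTE ne).
Qed.

Lemma expectation_norm2_isotropic (R : realType) (d : measure_display)
    (T : measurableType d) (P : probability T R) (m n : nat)
    (A : 'M[R]_(m, n)) (Z : T -> 'cV[R]_n) :
  isotropic P Z ->
  ('E_P[fun t => (euclidean_norm (A *m Z t) ^+ 2)%R] =
   ((frobenius_norm A ^+ 2)%R)%:E)%E.
Proof.
move=> isoZ; rewrite unlock.
have int_term i a b : P.-integrable [set: T]
    (fun t => ((A i a * A i b)%:E * (Z t a ord0 * Z t b ord0)%:E)%E).
  by apply: integrableZl => //; case: (isoZ a b).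
transitivity (\int[P]_t (\sum_(i < m) \sum_(a < n) \sum_(b < n)
    (A i a * A i b)%:E * (Z t a ord0 * Z t b ord0)%:E))%E.
  apply: eq_integral => t _.
  rewrite /euclidean_norm sqr_sqrtr ?sumr_ge0// => [|i _]; last exact: sqr_ge0.
  rewrite -sumEFin; apply: eq_bigr => i _.
  rewrite mxE expr2 big_distrlr/= -sumEFin; apply: eq_bigr => a _.
  rewrite -sumEFin; apply: eq_bigr => b _.
  by rewrite -EFinM mulrACA.
rewrite integral_sum// => [|i]; last first.
  by do 2 apply: integrable_sum => // ? _; exact: int_term.
rewrite /frobenius_norm sqr_sqrtr; last first.
  by apply: sumr_ge0 => i _; apply: sumr_ge0 => j _; exact: sqr_ge0.
rewrite -sumEFin; apply: eq_bigr => i _.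
rewrite integral_sum// => [|a]; last first.
  by apply: integrable_sum => // b _; exact: int_term.
rewrite -sumEFin; apply: eq_bigr => a _.
rewrite integral_sum// (bigD1 a)//= integralZl ?(isoZ a _).2//; last first.
  by case: (isoZ a a).
rewrite eqxx mule1 big1 ?adde0 ?expr2// => b ba.
rewrite integralZl//; last by case: (isoZ a b).
by rewrite (isoZ a b).2 eq_sym (negbTE ba) mule0.
Qed.

Theorem lemma2p1 (R : realType) (d : measure_display) (T : measurableType d)
    (P : probability T R) (m nhat ntilde : nat)
    (hm : (1 <= m)%N) (hnhat : (1 <= nhat)%N) (hntilde : (1 <= ntilde)%N)
    (A : 'M[R]_(m, ntilde * nhat))
    (xhat : T -> 'cV[R]_nhat) (xtilde : T -> 'cV[R]_ntilde)
    (rv_xhat : random_vector xhat) (rv_xtilde : random_vector xtilde)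
    (indep : independent_rvs P (joint_entries xhat xtilde))
    (mean0 : forall k, ('E_P[joint_entries xhat xtilde k] = 0)%E)
    (var1 : forall k, ('V_P[joint_entries xhat xtilde k] = 1)%E) :
  ('E_P[fun t => (euclidean_norm (A *m kron (xtilde t) (xhat t)) ^+ 2)%R] =
   ((frobenius_norm A ^+ 2)%R)%:E)%E.
Proof. exact/expectation_norm2_isotropic/isotropic_kron. Qed.
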